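(* Let $p,q\in\mathbb{R}$ and let $\nu\in\mathbb{R}$. Let $K_\nu$ be the modified Bessel function of the second kind. Then: (a) if $p\leq0$ and $q\geq1$, then $K_{\nu}$ is strictly $(p,q)$-convex on $(0,\infty)$ provided $\nu>1$ and $4(1-q)p^2\nu^2+4(q-2)p^2\nu+p^2(p^2+4)\leq0$; (b) if $p\leq0$ and $q\leq 0$, then $K_{\nu}$ is strictly $(p,q)$-concave on $(0,\infty)$; (c) if $p\geq0$ and $q<0$, then $K_{\nu}$ is strictly $(p,q)$-concave on $(0,\infty)$ provided $|\nu|\geq-p/q$; (d) if $p\geq0$ and $q\geq 1$, then $K_{\nu}$ is strictly $(p,q)$-convex on $(0,\infty)$; (e) if $p\geq1$ and $q\geq 0$, then $K_{\nu}$ is strictly $(p,q)$-convex on $(0,\infty)$.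
   Context: $K_\nu$ is the modified Bessel function of the second kind, given for $u>0$, $\nu\in\mathbb{R}$ by $K_{\nu}(u)=\int_0^{\infty}e^{-u\cosh t}\cosh(\nu t)\,dt$. For $r\in\mathbb{R}$, $\lambda\in[0,1]$ and $x,y>0$ define the weighted power mean $M_r^{(\lambda)}(x,y)=[\lambda x^r+(1-\lambda)y^r]^{1/r}$ if $r\neq0$ and $M_0^{(\lambda)}(x,y)=x^{\lambda}y^{1-\lambda}$. A function $f:(0,\infty)\to(0,\infty)$ is $(p,q)$-convex if $f(M_p^{(\lambda)}(u_1,u_2))\leq M_q^{(\lambda)}(f(u_1),f(u_2))$ for all $u_1,u_2>0$ and $\lambda\in[0,1]$, and $(p,q)$-concave if the reverse inequality holds; ''strictly'' means the inequality is strict whenever $u_1\neq u_2$ and $\lambda\in(0,1)$. *)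

(* Defs.v *)
From Stdlib Require Import Reals Lra.
From Coquelicot Require Import Coquelicot.
Open Scope R_scope.

Definition BesselK (nu u : R) : R :=
  RInt_gen (fun t => exp (- u * cosh t) * cosh (nu * t))
           (at_point 0) (Rbar_locally p_infty).

Definition power_mean (r lam x y : R) : R :=
  if Req_EM_T r 0 then Rpower x lam * Rpower y (1 - lam)
  else Rpower (lam * Rpower x r + (1 - lam) * Rpower y r) (/ r).

Definition strictly_pq_convex (f : R -> R) (p q : R) : Prop :=
  (forall u1 u2 lam, 0 < u1 -> 0 < u2 -> 0 <= lam <= 1 ->
     f (power_mean p lam u1 u2) <= power_mean q lam (f u1) (f u2)) /\
  (forall u1 u2 lam, 0 < u1 -> 0 < u2 -> u1 <> u2 -> 0 < lam < 1 ->
     f (power_mean p lam u1 u2) < power_mean q lam (f u1) (f u2)).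

Definition strictly_pq_concave (f : R -> R) (p q : R) : Prop :=
  (forall u1 u2 lam, 0 < u1 -> 0 < u2 -> 0 <= lam <= 1 ->
     f (power_mean p lam u1 u2) >= power_mean q lam (f u1) (f u2)) /\
  (forall u1 u2 lam, 0 < u1 -> 0 < u2 -> u1 <> u2 -> 0 < lam < 1 ->
     f (power_mean p lam u1 u2) > power_mean q lam (f u1) (f u2)).

(* Main.v *)
Require Import Defs.
From Stdlib Require Import Reals Classical_Prop Lra Psatz.
From Coquelicot Require Import Coquelicot.
Open Scope R_scope.

(** With [f = BesselK nu] and [v = - u f'/f], the map [u^(1-p) f^(q-1) f'] has a
    derivative of the sign of [Q = u^2 + nu^2 + (q-1) v^2 + p v], by the Bessel
    equation; where it is monotone, tangent-line comparison of [f^q / q] against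
    [u^p / p] (logarithms for exponent 0) gives the (p,q)-inequality. The sign of
    [Q] follows from [u^2 + nu^2 < v^2 < u^2 + nu^2 + v] and, for [nu > 1],
    [v^2 < nu/(nu-1) u^2 + nu^2]. Each of these bounds, multiplied by [f^2] or
    [f^2/u], says that a strictly increasing function vanishing at infinity is
    negative. The Bessel equation itself comes from
    [K_nu' = - (K_(nu-1) + K_(nu+1)) / 2] and the three-term recurrence. *)

(** * Hyperbolic identities and bounds on the integrand *)

Definition kernel (nu u t : R) : R := exp (- u * cosh t) * cosh (nu * t).

Lemma exp_le (x y : R) : x <= y -> exp x <= exp y.
Proof. intros [H | ->]; [left; now apply exp_increasing | right; reflexivity]. Qed.

Lemma cosh_ge_1 (t : R) : 1 <= cosh t.
Proof.
unfold cosh; assert (H1 := exp_pos t); assert (H2 := exp_pos (- t)).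
assert (exp t * exp (- t) = 1) by (rewrite <- exp_plus, Rplus_opp_r; apply exp_0).
assert (0 <= exp (- t) * (exp t - 1) ^ 2) by (apply Rmult_le_pos; [lra | apply pow2_ge_0]).
nra.
Qed.

Lemma cosh_mul_cosh (nu t : R) :
  cosh t * cosh (nu * t) = (cosh ((nu - 1) * t) + cosh ((nu + 1) * t)) / 2.
Proof.
unfold cosh.
replace ((nu - 1) * t) with (nu * t + - t) by ring.
replace ((nu + 1) * t) with (nu * t + t) by ring.
rewrite !Ropp_plus_distr, Ropp_involutive, !exp_plus; field.
Qed.

Lemma sinh_mul_sinh (nu t : R) :
  sinh t * sinh (nu * t) = (cosh ((nu + 1) * t) - cosh ((nu - 1) * t)) / 2.
Proof.
unfold cosh, sinh.
replace ((nu - 1) * t) with (nu * t + - t) by ring.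
replace ((nu + 1) * t) with (nu * t + t) by ring.
rewrite !Ropp_plus_distr, Ropp_involutive, !exp_plus; field.
Qed.

Lemma kernel_pos (nu u t : R) : 0 < kernel nu u t.
Proof.
unfold kernel; apply Rmult_lt_0_compat; [apply exp_pos|].
assert (H := cosh_ge_1 (nu * t)); lra.
Qed.

Lemma continuous_kernel (nu u t : R) : continuous (kernel nu u) t.
Proof.
apply (ex_derive_continuous (kernel nu u)); unfold kernel, cosh; auto_derive; trivial.
Qed.

(** Squaring [1 + x / 2 <= exp (x / 2)] gives the bound. *)
Lemma exp_ge_sqr (x : R) : 0 <= x -> x ^ 2 / 4 <= exp x.
Proof.
intros Hx; replace (exp x) with (exp (x / 2) * exp (x / 2)) by (rewrite <- exp_plus; f_equal; field).
assert (H := exp_ineq1_le (x / 2)); nra.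
Qed.


(** Since [cosh t >= t^2 / 8], the exponent on the left is at most a concave quadratic in [t],
    bounded by completing the square. The bound serves both for the convergence of the integral and
    for the boundary term at infinity in the recurrence. *)
Lemma exp_cosh_dominated (nu u t : R) : 0 < u -> 0 <= t ->
  exp (- u * cosh t) * exp (Rabs (nu * t)) <= exp (2 * (Rabs nu + 1) ^ 2 / u) * exp (- t).
Proof.
intros Hu Ht; rewrite Rabs_mult, (Rabs_pos_eq t) by lra.
rewrite <- !exp_plus; apply exp_le.
assert (Hc : t ^ 2 / 8 <= cosh t).
{ unfold cosh; assert (H := exp_ge_sqr t Ht); assert (H' := exp_pos (- t)); lra. }
(* The expanded square says [(|nu| + 1) t - u t^2 / 8 <= 2 (|nu| + 1)^2 / u]. *)
assert (0 <= (Rabs nu + 1 - u * t / 4) ^ 2 * (2 / u)).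
{ apply Rmult_le_pos; [apply pow2_ge_0|]; apply Rlt_le, Rdiv_lt_0_compat; lra. }
replace ((Rabs nu + 1 - u * t / 4) ^ 2 * (2 / u)) with
  (2 * (Rabs nu + 1) ^ 2 / u - (Rabs nu + 1) * t + u * (t ^ 2 / 8)) in H by (field; lra).
nra.
Qed.

Lemma cosh_le_exp_abs (x : R) : cosh x <= exp (Rabs x).
Proof.
unfold cosh.
assert (exp x <= exp (Rabs x)) by (apply exp_le, Rle_abs).
assert (exp (- x) <= exp (Rabs x)) by (apply exp_le; rewrite <- Rabs_Ropp; apply Rle_abs).
lra.
Qed.

Lemma abs_sinh_le_exp_abs (x : R) : Rabs (sinh x) <= exp (Rabs x).
Proof.
unfold sinh.
assert (exp x <= exp (Rabs x)) by (apply exp_le, Rle_abs).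
assert (exp (- x) <= exp (Rabs x)) by (apply exp_le; rewrite <- Rabs_Ropp; apply Rle_abs).
assert (H1 := exp_pos x); assert (H2 := exp_pos (- x)).
apply Rabs_le; lra.
Qed.

(** * The improper integral *)

Definition improper (g : R -> R) (l : R) : Prop :=
  is_RInt_gen g (at_point 0) (Rbar_locally p_infty) l.

Lemma filter_prod_halfline (P : R * R -> Prop) :
  (forall x, 0 <= x -> P (0, x)) -> filter_prod (at_point 0) (Rbar_locally p_infty) P.
Proof.
intros HP; apply (Filter_prod _ _ _ (fun a => a = 0) (fun x => 0 < x)).
- reflexivity.
- now exists 0.
- intros a x -> Hx; apply HP; lra.
Qed.

Lemma improper_ext (f g : R -> R) (l : R) :
  (forall t, f t = g t) -> improper f l -> improper g l.
Proof.
intros Hfg; apply is_RInt_gen_ext, filter_prod_halfline.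
intros; apply Hfg.
Qed.

Lemma improper_lin (f g : R -> R) (a b lf lg : R) : improper f lf -> improper g lg ->
  improper (fun t => a * f t + b * g t) (a * lf + b * lg).
Proof.
intros Hf Hg.
exact (is_RInt_gen_plus _ _ _ _ (is_RInt_gen_scal _ a _ Hf) (is_RInt_gen_scal _ b _ Hg)).
Qed.

Lemma improper_abs_le (f g : R -> R) (lf lg : R) :
  (forall t, 0 <= t -> Rabs (f t) <= g t) -> improper f lf -> improper g lg -> Rabs lf <= lg.
Proof.
intros Hfg; apply (RInt_gen_norm (V := R_CompleteNormedModule)); apply filter_prod_halfline; simpl; trivial.
intros x _ t Ht; apply Hfg; lra.
Qed.

Lemma improper_unique (g : R -> R) (l1 l2 : R) : improper g l1 -> improper g l2 -> l1 = l2.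
Proof.
intros H1 H2; rewrite <- (is_RInt_gen_unique (V := R_CompleteNormedModule) _ _ H1).
now apply is_RInt_gen_unique.
Qed.

(** The partial integrals increase and are bounded by [C], so they converge to their supremum. That
    they stay below the limit is recorded for the proof of positivity. *)
Lemma ex_improper_dominated (g : R -> R) (C : R) :
  (forall t, continuous g t) -> (forall t, 0 <= g t) ->
  (forall t, 0 <= t -> g t <= C * exp (- t)) ->
  exists l, improper g l /\ forall x, 0 <= x -> RInt g 0 x <= l.
Proof.
intros Hc Hpos Hdom.
assert (Hex : forall a b, ex_RInt g a b).
{ intros; apply (ex_RInt_continuous (V := R_CompleteNormedModule)); intros; apply Hc. }
assert (HC : 0 <= C).
{ assert (H := Hdom 0 (Rle_refl 0)); assert (H' := Hpos 0).
  rewrite Ropp_0, exp_0 in H; lra. }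
assert (Hincr : forall x y, 0 <= x <= y -> RInt g 0 x <= RInt g 0 y).
{ intros x y Hxy.
  rewrite <- (RInt_Chasles (V := R_CompleteNormedModule) g 0 x y) by apply Hex.
  assert (0 <= RInt g x y) by (apply RInt_ge_0; auto; lra).
  unfold plus; simpl; lra. }
assert (Hbd : forall x, 0 <= x -> RInt g 0 x <= C).
{ intros x Hx.
  assert (Hprim : is_RInt (fun t => C * exp (- t)) 0 x (minus (- C * exp (- x)) (- C * exp (- 0)))).
  { apply (is_RInt_derive (fun t => - C * exp (- t))).
    - intros t _; auto_derive; trivial; ring.
    - intros t _; apply (ex_derive_continuous (fun t => C * exp (- t))); auto_derive; trivial. }
  apply Rle_trans with (RInt (fun t => C * exp (- t)) 0 x).
  - apply RInt_le; auto.
    + eexists; exact Hprim.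
    + intros t Ht; apply Hdom; lra.
  - rewrite (is_RInt_unique _ _ _ _ Hprim); unfold minus, plus, opp; simpl.
    rewrite Ropp_0, exp_0; assert (H := exp_pos (- x)); nra. }
destruct (completeness (fun y => exists x, 0 <= x /\ y = RInt g 0 x)) as [l [Hub Hlub]].
{ exists C; intros y [x [Hx ->]]; auto. }
{ exists (RInt g 0 0), 0; split; [lra | reflexivity]. }
assert (Hle : forall x, 0 <= x -> RInt g 0 x <= l) by (intros x Hx; apply Hub; now exists x).
exists l; split; [|exact Hle].
intros P [eps HP].
assert (Hnear : exists x0, 0 <= x0 /\ l - eps < RInt g 0 x0).
{ apply NNPP; intros Hn.
  assert (l <= l - eps).
  { apply Hlub; intros y [x [Hx ->]]; apply Rnot_lt_le; intros H; apply Hn; now exists x. }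
  assert (H' := cond_pos eps); lra. }
destruct Hnear as [x0 [Hx0 Hlt]].
apply (Filter_prod _ _ _ (fun a => a = 0) (fun x => x0 < x)).
- reflexivity.
- now exists x0.
- intros a x -> Hx; exists (RInt g 0 x); split.
  + apply (RInt_correct (V := R_CompleteNormedModule)), Hex.
  + apply HP; unfold ball; simpl; unfold AbsRing_ball, abs, minus, plus, opp; simpl.
    assert (H1 := Hle x ltac:(lra)); assert (H2 := Hincr x0 x ltac:(lra)).
    apply Rabs_def1; assert (H' := cond_pos eps); lra.
Qed.

(** * Convergence, derivative, decay and recurrence of the Bessel integral *)

Lemma BesselK_integral (nu u : R) : 0 < u -> improper (kernel nu u) (BesselK nu u) /\ 0 < BesselK nu u.
Proof.
intros Hu.
destruct (ex_improper_dominated (kernel nu u) (exp (2 * (Rabs nu + 1) ^ 2 / u))) as [l [Hl Hle]].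
- apply continuous_kernel.
- intros t; apply Rlt_le, kernel_pos.
- intros t Ht; eapply Rle_trans; [|now apply exp_cosh_dominated].
  apply Rmult_le_compat_l; [apply Rlt_le, exp_pos | apply cosh_le_exp_abs].
- assert (HK : BesselK nu u = l) by (apply is_RInt_gen_unique, Hl).
  rewrite HK; split; trivial.
  (* The integral over [[0, 1]] is already positive. *)
  apply Rlt_le_trans with (2 := Hle 1 Rle_0_1).
  apply RInt_gt_0; [lra | |]; intros; [apply kernel_pos | apply continuous_kernel].
Qed.

Lemma BesselK_pos (nu u : R) : 0 < u -> 0 < BesselK nu u.
Proof. intros Hu; now apply BesselK_integral. Qed.

Lemma cosh_mul_kernel (nu u t : R) :
  cosh t * kernel nu u t = / 2 * kernel (nu - 1) u t + / 2 * kernel (nu + 1) u t.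
Proof. assert (H := cosh_mul_cosh nu t); unfold kernel; nra. Qed.

Lemma improper_cosh_kernel (nu u : R) : 0 < u ->
  improper (fun t => cosh t * kernel nu u t) (/ 2 * BesselK (nu - 1) u + / 2 * BesselK (nu + 1) u).
Proof.
intros Hu; apply improper_ext with (1 := fun t => eq_sym (cosh_mul_kernel nu u t)).
now apply improper_lin; apply BesselK_integral.
Qed.

(** Two uses of the product formula reduce the integrand to kernels. The value is the constant in
    the Taylor remainder when differentiating under the integral. *)
Lemma improper_cosh2_kernel (nu u : R) : 0 < u ->
  exists l, improper (fun t => cosh t ^ 2 * kernel nu u t) l.
Proof.
intros Hu; eexists.
apply improper_ext with (fun t => / 2 * (cosh t * kernel (nu - 1) u t) + / 2 * (cosh t * kernel (nu + 1) u t)).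
- intros t; assert (H := cosh_mul_kernel nu u t); simpl.
  rewrite Rmult_1_r, Rmult_assoc, H; ring.
- now apply improper_lin; apply improper_cosh_kernel.
Qed.

(** Two uses of the mean value theorem give [exp y - 1 - y = c y exp d], with [c] between 0 and [y]
    and [d] between 0 and [c]. *)
Lemma exp_taylor_bound (y : R) : Rabs (exp y - 1 - y) <= y ^ 2 * exp (Rabs y).
Proof.
assert (Hlow : 0 <= exp y - 1 - y) by (assert (H := exp_ineq1_le y); lra).
rewrite Rabs_pos_eq by trivial.
destruct (MVT_gen exp 0 y exp) as [c [Hc Heq]].
- intros; auto_derive; trivial; ring.
- intros; apply derivable_continuous_pt, derivable_pt_exp.
- destruct (MVT_gen exp 0 c exp) as [d [Hd Heq']].
  + intros; auto_derive; trivial; ring.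
  + intros; apply derivable_continuous_pt, derivable_pt_exp.
  + rewrite exp_0 in Heq, Heq'.
    assert (He : exp y - 1 - y = c * y * exp d).
    { replace (exp c) with (1 + exp d * (c - 0)) in Heq by lra; nra. }
    rewrite He; assert (0 <= c * y <= y ^ 2 /\ d <= Rabs y).
    { unfold Rmin, Rmax in Hc, Hd; unfold Rabs.
      destruct (Rle_dec 0 y), (Rle_dec 0 c), (Rcase_abs y); try lra; repeat split; nra. }
    apply Rmult_le_compat; try lra; [apply Rlt_le, exp_pos | apply exp_le; lra].
Qed.

(** Differentiation under the integral sign: [exp_taylor_bound] at [y = - h cosh t], integrated in
    [t], bounds the first-order remainder by [h^2 M], where [M] is the integral of [cosh t ^ 2]
    against the kernel at [u / 2]. *)
Lemma is_derive_BesselK (nu u : R) : 0 < u ->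
  is_derive (BesselK nu) u (- (BesselK (nu - 1) u + BesselK (nu + 1) u) / 2).
Proof.
intros Hu; destruct (improper_cosh2_kernel nu (u / 2)) as [M HM]; [lra|].
assert (Hrem : forall h, Rabs h < u / 2 ->
  Rabs (BesselK nu (u + h) - BesselK nu u - h * (- (BesselK (nu - 1) u + BesselK (nu + 1) u) / 2))
    <= h ^ 2 * M).
{ intros h Hh; assert (Hh' := Rabs_def2 _ _ Hh).
  assert (Hu1 : 0 < u + h) by lra.
  (* Both integrands are written as linear combinations, so that [improper_lin] supplies their
     integrals. *)
  apply improper_abs_le with
    (fun t => 1 * (1 * kernel nu (u + h) t + (- 1) * kernel nu u t) + h * (cosh t * kernel nu u t))
    (fun t => h ^ 2 * (cosh t ^ 2 * kernel nu (u / 2) t) + 0 * kernel nu u t).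
  - intros t Ht; assert (Hc := cosh_ge_1 t).
    assert (Hn := cosh_ge_1 (nu * t)).
    assert (Hy : kernel nu (u + h) t = exp (- (h * cosh t)) * kernel nu u t).
    { unfold kernel; rewrite <- Rmult_assoc, <- exp_plus; do 2 f_equal; ring. }
    rewrite Hy.
    replace (1 * (1 * (exp (- (h * cosh t)) * kernel nu u t) + -1 * kernel nu u t) + h * (cosh t * kernel nu u t))
      with ((exp (- (h * cosh t)) - 1 - (- (h * cosh t))) * kernel nu u t) by ring.
    rewrite Rabs_mult, (Rabs_pos_eq (kernel nu u t)) by apply Rlt_le, kernel_pos.
    apply Rle_trans with ((- (h * cosh t)) ^ 2 * exp (Rabs (- (h * cosh t))) * kernel nu u t).
    { apply Rmult_le_compat_r; [apply Rlt_le, kernel_pos | apply exp_taylor_bound]. }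
    rewrite Rabs_Ropp, Rabs_mult, (Rabs_pos_eq (cosh t)) by lra.
    unfold kernel.
    replace ((- (h * cosh t)) ^ 2 * exp (Rabs h * cosh t) * (exp (- u * cosh t) * cosh (nu * t)))
      with ((h * cosh t) ^ 2 * cosh (nu * t) * exp (Rabs h * cosh t + - u * cosh t))
      by (rewrite exp_plus; ring).
    replace (h ^ 2 * (cosh t ^ 2 * (exp (- (u / 2) * cosh t) * cosh (nu * t))) + 0 * (exp (- u * cosh t) * cosh (nu * t)))
      with ((h * cosh t) ^ 2 * cosh (nu * t) * exp (- (u / 2) * cosh t)) by ring.
    apply Rmult_le_compat_l; [apply Rmult_le_pos; [apply pow2_ge_0 | lra]|].
    (* Here [|h| < u / 2] gives [|h| - u <= - u / 2]. *)
    apply exp_le; nra.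
  - replace (BesselK nu (u + h) - BesselK nu u - h * (- (BesselK (nu - 1) u + BesselK (nu + 1) u) / 2))
      with (1 * (1 * BesselK nu (u + h) + (- 1) * BesselK nu u)
            + h * (/ 2 * BesselK (nu - 1) u + / 2 * BesselK (nu + 1) u)) by field.
    apply improper_lin; [apply improper_lin; now apply BesselK_integral | now apply improper_cosh_kernel].
  - replace (h ^ 2 * M) with (h ^ 2 * M + 0 * BesselK nu u) by ring.
    apply improper_lin; [exact HM | now apply BesselK_integral]. }
assert (HM0 : 0 <= M).
{ apply Rle_trans with (Rabs M); [apply Rabs_pos|].
  apply improper_abs_le with (2 := HM) (3 := HM); intros t _.
  rewrite Rabs_pos_eq; [lra|].
  apply Rmult_le_pos; [apply pow2_ge_0 | apply Rlt_le, kernel_pos]. }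
apply is_derive_Reals; intros eps Heps.
(* The denominator [M + 1] is positive even if [M = 0]. *)
assert (Hd : 0 < Rmin (u / 2) (eps / (M + 1))).
{ apply Rmin_glb_lt; [lra | apply Rdiv_lt_0_compat; lra]. }
exists (mkposreal _ Hd); simpl; intros h Hh0 Hh.
assert (Hh1 := Rlt_le_trans _ _ _ Hh (Rmin_l _ _)).
assert (Hh2 := Rlt_le_trans _ _ _ Hh (Rmin_r _ _)).
specialize (Hrem h Hh1).
set (d := - (BesselK (nu - 1) u + BesselK (nu + 1) u) / 2) in *.
replace ((BesselK nu (u + h) - BesselK nu u) / h - d)
  with ((BesselK nu (u + h) - BesselK nu u - h * d) / h) by (field; trivial).
rewrite Rabs_div by trivial.
assert (Hhp := Rabs_pos_lt h Hh0).
apply Rmult_lt_reg_r with (Rabs h); trivial.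
unfold Rdiv at 1; rewrite Rmult_assoc, Rinv_l, Rmult_1_r by lra.
apply Rle_lt_trans with (1 := Hrem).
rewrite <- (pow2_abs h).
assert (Rabs h * (M + 1) < eps).
{ apply Rmult_lt_compat_r with (r := M + 1) in Hh2; [|lra].
  unfold Rdiv in Hh2; rewrite Rmult_assoc, Rinv_l, Rmult_1_r in Hh2; lra. }
nra.
Qed.

(** The kernel at [u] is the kernel at 1 times [exp (- (u - 1) cosh t)], which is at most
    [e / exp u <= 3 / (u^2 / 4)]. *)
Lemma BesselK_decay (nu : R) : exists C, 0 <= C /\ forall u, 1 <= u -> BesselK nu u <= C / u ^ 2.
Proof.
exists (12 * BesselK nu 1); assert (HK := BesselK_pos nu 1 Rlt_0_1); split; [lra|].
intros u Hu.
assert (Hint : Rabs (BesselK nu u) <= 12 / u ^ 2 * BesselK nu 1 + 0 * BesselK nu 1).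
{ apply improper_abs_le with (kernel nu u)
    (fun t => 12 / u ^ 2 * kernel nu 1 t + 0 * kernel nu 1 t).
  - intros t _; rewrite Rabs_pos_eq by apply Rlt_le, kernel_pos.
    replace (kernel nu u t) with (exp (- ((u - 1) * cosh t)) * kernel nu 1 t).
    2:{ unfold kernel; rewrite <- Rmult_assoc, <- exp_plus; do 2 f_equal; ring. }
    rewrite Rmult_0_l, Rplus_0_r.
    apply Rmult_le_compat_r; [apply Rlt_le, kernel_pos|].
    apply Rle_trans with (exp 1 * / exp u).
    + rewrite <- exp_Ropp, <- exp_plus; apply exp_le.
      assert (H := cosh_ge_1 t); nra.
    + assert (H3 := exp_le_3); assert (He := exp_ge_sqr u ltac:(lra)).
      assert (0 < u ^ 2) by (apply pow_lt; lra).
      apply Rle_trans with (3 * / (u ^ 2 / 4)).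
      * apply Rmult_le_compat; try lra.
        -- apply Rlt_le, exp_pos.
        -- apply Rlt_le, Rinv_0_lt_compat, exp_pos.
        -- apply Rinv_le_contravar; lra.
      * right; field; lra.
  - apply BesselK_integral; lra.
  - apply improper_lin; apply BesselK_integral; lra. }
rewrite Rabs_pos_eq in Hint by (apply Rlt_le, BesselK_pos; lra).
apply Rle_trans with (1 := Hint); right; field; lra.
Qed.

(** Integrate the derivative of [exp (- u cosh t) sinh (nu t)] over the half-line. Both boundary
    values vanish, and the formula for [sinh t * sinh (nu * t)] turns the derivative into kernels of
    orders [nu - 1], [nu], [nu + 1]. *)
Lemma BesselK_recurrence (nu u : R) : 0 < u ->
  u * (BesselK (nu + 1) u - BesselK (nu - 1) u) = 2 * nu * BesselK nu u.
Proof.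
intros Hu.
set (F := fun t => exp (- u * cosh t) * sinh (nu * t)).
assert (HD : forall t, is_derive F t (nu * kernel nu u t
   + 1 * ((- (u / 2)) * kernel (nu + 1) u t + (u / 2) * kernel (nu - 1) u t))).
{ intros t; unfold F, kernel.
  evar_last.
  - unfold cosh, sinh; auto_derive; trivial.
  - assert (Hs := sinh_mul_sinh nu t).
    transitivity (nu * (exp (- u * cosh t) * cosh (nu * t)) - u * exp (- u * cosh t) * (sinh t * sinh (nu * t))).
    + unfold cosh, sinh, Rdiv; ring.
    + rewrite Hs; field. }
assert (HI : improper (fun t => nu * kernel nu u t
   + 1 * ((- (u / 2)) * kernel (nu + 1) u t + (u / 2) * kernel (nu - 1) u t)) (0 - F 0)).
{ apply improper_ext with (Derive F).
  { intros t; apply is_derive_unique, HD. }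
  apply is_RInt_gen_Derive.
  - apply filter_prod_halfline; intros; eexists; apply HD.
  - apply filter_prod_halfline; intros x _ t _.
    apply continuous_ext with (fun t => nu * kernel nu u t
      + 1 * ((- (u / 2)) * kernel (nu + 1) u t + (u / 2) * kernel (nu - 1) u t)).
    { intros s; symmetry; apply is_derive_unique, HD. }
    apply (ex_derive_continuous (fun t => nu * kernel nu u t
      + 1 * ((- (u / 2)) * kernel (nu + 1) u t + (u / 2) * kernel (nu - 1) u t))).
    unfold kernel, cosh; auto_derive; trivial.
  - intros P HP; exact (locally_singleton _ _ HP).
  (* At infinity [F] is squeezed between two multiples of [exp (- t)]. *)
  - set (C := exp (2 * (Rabs nu + 1) ^ 2 / u)).
    assert (Hlim : is_lim (fun t => C * exp (- t)) p_infty (C * 0)).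
    { apply (is_lim_scal_l (fun t => exp (- t)) C p_infty 0).
      apply (is_lim_comp exp (fun t => - t) p_infty 0 m_infty).
      - apply is_lim_exp_m.
      - apply (is_lim_opp (fun t => t) p_infty p_infty), is_lim_id.
      - now exists 0. }
    rewrite Rmult_0_r in Hlim.
    apply (is_lim_le_le_loc (fun t => - (C * exp (- t))) (fun t => C * exp (- t)) F p_infty 0); trivial.
    + exists 0; intros t Ht; apply Rabs_le_between.
      unfold F; rewrite Rabs_mult, (Rabs_pos_eq (exp _)) by apply Rlt_le, exp_pos.
      apply Rle_trans with (exp (- u * cosh t) * exp (Rabs (nu * t))).
      * apply Rmult_le_compat_l; [apply Rlt_le, exp_pos | apply abs_sinh_le_exp_abs].
      * apply exp_cosh_dominated; lra.
    + replace (Finite 0) with (Rbar_opp 0) by (simpl; f_equal; ring).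
      now apply is_lim_opp. }
replace (F 0) with 0 in HI.
2:{ unfold F; rewrite Rmult_0_r; unfold sinh; rewrite Ropp_0, exp_0; field. }
assert (Heq := improper_unique _ _ _ HI (improper_lin _ _ nu 1 _ _ (proj1 (BesselK_integral nu u Hu))
  (improper_lin _ _ (- (u / 2)) (u / 2) _ _ (proj1 (BesselK_integral (nu + 1) u Hu))
    (proj1 (BesselK_integral (nu - 1) u Hu))))).
lra.
Qed.

(** * Bessel's equation and bounds on the logarithmic derivative *)

Definition dBesselK (nu u : R) : R := - (BesselK (nu - 1) u + BesselK (nu + 1) u) / 2.

Lemma dBesselK_neg (nu u : R) : 0 < u -> dBesselK nu u < 0.
Proof.
intros Hu; unfold dBesselK.
assert (H1 := BesselK_pos (nu - 1) u Hu); assert (H2 := BesselK_pos (nu + 1) u Hu); lra.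
Qed.

(** The second derivative as solved from Bessel's equation [u^2 y'' + u y' = (u^2 + nu^2) y]. *)
Definition d2BesselK (nu u : R) : R :=
  (u ^ 2 + nu ^ 2) / u ^ 2 * BesselK nu u - dBesselK nu u / u.

(** Differentiating the half-sum of neighbours brings in the orders [nu - 2] and [nu + 2]; the
    recurrence at [nu - 1] and [nu + 1] eliminates them. *)
Lemma is_derive_dBesselK (nu u : R) : 0 < u -> is_derive (dBesselK nu) u (d2BesselK nu u).
Proof.
intros Hu.
assert (H1 := is_derive_BesselK (nu - 1) u Hu); assert (H2 := is_derive_BesselK (nu + 1) u Hu).
assert (R0 := BesselK_recurrence nu u Hu).
assert (R1 := BesselK_recurrence (nu - 1) u Hu).
assert (R2 := BesselK_recurrence (nu + 1) u Hu).
unfold dBesselK; evar_last.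
- apply (is_derive_ext (fun v => scal (- / 2) (plus (BesselK (nu - 1) v) (BesselK (nu + 1) v)))).
  + intros v; unfold scal, plus; simpl; unfold mult; simpl; field.
  + exact (is_derive_scal _ _ (- / 2) _ (is_derive_plus _ _ _ _ _ H1 H2)).
- unfold plus, d2BesselK, dBesselK; simpl.
  replace (nu - 1 + 1) with nu in * by ring; replace (nu + 1 - 1) with nu in * by ring.
  assert (E0 : nu * BesselK nu u = u * (BesselK (nu + 1) u - BesselK (nu - 1) u) / 2) by lra.
  assert (E1 : BesselK (nu - 1 - 1) u = BesselK nu u - 2 * (nu - 1) * BesselK (nu - 1) u / u).
  { rewrite <- R1; field; lra. }
  assert (E2 : BesselK (nu + 1 + 1) u = BesselK nu u + 2 * (nu + 1) * BesselK (nu + 1) u / u).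
  { rewrite <- R2; field; lra. }
  rewrite E1, E2.
  (* The term in [nu^2] is split so that the recurrence at [nu] can absorb one factor [nu]. *)
  replace ((u * (u * 1) + nu * (nu * 1)) / (u * (u * 1)) * BesselK nu u)
    with (BesselK nu u + nu * (nu * BesselK nu u) / u ^ 2) by (field; lra).
  rewrite E0; field; lra.
Qed.

Lemma Derive_BesselK (nu u : R) : 0 < u -> Derive (fun v : R => BesselK nu v) u = dBesselK nu u.
Proof. intros Hu; now apply is_derive_unique, is_derive_BesselK. Qed.

Lemma Derive_dBesselK (nu u : R) : 0 < u -> Derive (fun v : R => dBesselK nu v) u = d2BesselK nu u.
Proof. intros Hu; now apply is_derive_unique, is_derive_dBesselK. Qed.

Lemma dBesselK_decay (nu : R) : exists C, 0 <= C /\ forall u, 1 <= u -> - dBesselK nu u <= C / u ^ 2.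
Proof.
destruct (BesselK_decay (nu - 1)) as [C1 [HC1 H1]]; destruct (BesselK_decay (nu + 1)) as [C2 [HC2 H2]].
exists ((C1 + C2) / 2); split; [lra|]; intros u Hu; unfold dBesselK.
replace ((C1 + C2) / 2 / u ^ 2) with ((C1 / u ^ 2 + C2 / u ^ 2) / 2) by (field; lra).
specialize (H1 u Hu); specialize (H2 u Hu); lra.
Qed.

Lemma strictly_increasing_of_derive (F dF : R -> R) :
  (forall u, 0 < u -> is_derive F u (dF u)) -> (forall u, 0 < u -> 0 < dF u) ->
  forall x y, 0 < x -> x < y -> F x < F y.
Proof.
intros HF HdF x y Hx Hxy.
apply (incr_function F 0 p_infty dF); simpl; auto; intros; now apply HdF.
Qed.

(** If [F u >= 0], then [F] exceeds the positive value [F (u + 1)] at all later points, against the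
    bound [C / u]. *)
Lemma increasing_vanishing_neg (F dF : R -> R) (C : R) :
  (forall u, 0 < u -> is_derive F u (dF u)) -> (forall u, 0 < u -> 0 < dF u) ->
  (forall u, 1 <= u -> F u <= C / u) ->
  forall u, 0 < u -> F u < 0.
Proof.
intros HF HdF HC u Hu; assert (Hincr := strictly_increasing_of_derive F dF HF HdF).
apply Rnot_le_lt; intros Hneg.
assert (Hpos : 0 < F (u + 1)) by (assert (H := Hincr u (u + 1) Hu ltac:(lra)); lra).
set (eps := F (u + 1)) in *.
(* Chosen so that [eps * x = eps * (u + 2) + |C|] exceeds [C]. *)
set (x := u + 2 + Rabs C / eps).
assert (Hq : 0 <= Rabs C / eps) by (apply Rdiv_le_0_compat; [apply Rabs_pos | trivial]).
assert (Hx : eps < F x) by (apply Hincr; unfold x; lra).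
assert (Hx' := HC x ltac:(unfold x; lra)).
assert (Hlt : eps * x < C).
{ apply Rmult_lt_reg_r with (/ x); [apply Rinv_0_lt_compat; unfold x; lra|].
  rewrite Rmult_assoc, Rinv_r by (unfold x; lra); unfold Rdiv in Hx'; lra. }
assert (Heq : eps * x = eps * (u + 2) + Rabs C) by (unfold x; field; lra).
assert (H := Rle_abs C); nra.
Qed.

(** Turns the quadratic decay of [BesselK] and [dBesselK] into the form required by
    [increasing_vanishing_neg]. *)
Lemma sqr_decay (C a u : R) : 1 <= u -> 0 <= a <= C / u ^ 2 -> u ^ 2 * a ^ 2 <= C ^ 2 / u.
Proof.
intros Hu Ha.
assert (Hu2 : u ^ 2 * a <= C).
{ apply Rmult_le_reg_r with (/ u ^ 2); [apply Rinv_0_lt_compat, pow_lt; lra|].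
  replace (u ^ 2 * a * / u ^ 2) with a by (field; lra); apply Ha. }
apply Rmult_le_reg_r with u; [lra|].
replace (C ^ 2 / u * u) with (C ^ 2) by (field; lra).
assert (u ^ 2 * a ^ 2 * u <= (u ^ 2 * a) ^ 2).
{ assert (0 <= u ^ 3 * a ^ 2 * (u - 1)); [|nra].
  apply Rmult_le_pos; [apply Rmult_le_pos; [apply pow_le; lra | apply pow2_ge_0] | lra]. }
assert (0 <= u ^ 2 * a) by (apply Rmult_le_pos; [apply pow_le; lra | lra]).
nra.
Qed.

(** By Bessel's equation all terms containing [K'] cancel in the derivative of the difference, which
    leaves [2 u K^2]. *)
Lemma BesselK_log_derivative_lower (nu u : R) : 0 < u ->
  (u ^ 2 + nu ^ 2) * BesselK nu u ^ 2 < u ^ 2 * dBesselK nu u ^ 2.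
Proof.
destruct (BesselK_decay nu) as [C [HC HCu]]; revert u.
assert (H := increasing_vanishing_neg
  (fun u => (u ^ 2 + nu ^ 2) * BesselK nu u ^ 2 - u ^ 2 * dBesselK nu u ^ 2)
  (fun u => 2 * u * BesselK nu u ^ 2) ((1 + nu ^ 2) * C ^ 2)).
intros u Hu; apply Rminus_lt, H; trivial; clear u Hu; intros u Hu.
- assert (H0 := is_derive_BesselK nu u Hu); assert (H1 := is_derive_dBesselK nu u Hu).
  fold (dBesselK nu u) in H0.
  auto_derive.
  + split; [|split]; trivial; eexists; eassumption.
  + rewrite Derive_BesselK, Derive_dBesselK by trivial; unfold d2BesselK; field; lra.
- apply Rmult_lt_0_compat; [lra | now apply pow_lt, BesselK_pos].
- assert (H0 := BesselK_pos nu u ltac:(lra)).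
  assert (H1 := sqr_decay C (BesselK nu u) u Hu ltac:(split; [lra | auto])).
  assert (0 <= u ^ 2 * dBesselK nu u ^ 2) by (apply Rmult_le_pos; apply pow2_ge_0).
  assert (nu ^ 2 * BesselK nu u ^ 2 <= nu ^ 2 * (u ^ 2 * BesselK nu u ^ 2)).
  { apply Rmult_le_compat_l; [apply pow2_ge_0|]; assert (0 <= BesselK nu u ^ 2) by apply pow2_ge_0; assert (1 <= u ^ 2) by nra; nra. }
  replace ((1 + nu ^ 2) * C ^ 2 / u) with ((1 + nu ^ 2) * (C ^ 2 / u)) by (field; lra).
  assert (H4 := Rmult_le_compat_l (nu ^ 2) _ _ (pow2_ge_0 nu) H1); lra.
Qed.

(** By Bessel's equation this is [K'^2 < K K'']. After division by [u], the difference of the two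
    sides has derivative [(2 nu^2 K^2 - u K K') / u^2], positive because [K' < 0]. *)
Lemma BesselK_log_convex (nu u : R) : 0 < u ->
  u ^ 2 * dBesselK nu u ^ 2 + u * BesselK nu u * dBesselK nu u < (u ^ 2 + nu ^ 2) * BesselK nu u ^ 2.
Proof.
destruct (dBesselK_decay nu) as [C [HC HCu]]; revert u.
assert (H := increasing_vanishing_neg
  (fun u => u * dBesselK nu u ^ 2 + BesselK nu u * dBesselK nu u - (u ^ 2 + nu ^ 2) * BesselK nu u ^ 2 / u)
  (fun u => (2 * nu ^ 2 * BesselK nu u ^ 2 - u * BesselK nu u * dBesselK nu u) / u ^ 2) (C ^ 2)).
intros u Hu; apply Rmult_lt_reg_r with (/ u); [now apply Rinv_0_lt_compat|].
apply Rminus_lt.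
replace (_ - _) with
  (u * dBesselK nu u ^ 2 + BesselK nu u * dBesselK nu u - (u ^ 2 + nu ^ 2) * BesselK nu u ^ 2 / u)
  by (field; lra).
apply H; trivial; clear u Hu; intros u Hu.
- assert (H0 := is_derive_BesselK nu u Hu); assert (H1 := is_derive_dBesselK nu u Hu).
  fold (dBesselK nu u) in H0.
  auto_derive.
  + repeat split; try (eexists; eassumption); lra.
  + rewrite Derive_BesselK, Derive_dBesselK by trivial; unfold d2BesselK; field; lra.
- assert (H0 := BesselK_pos nu u Hu); assert (H1 := dBesselK_neg nu u Hu).
  apply Rdiv_lt_0_compat; [|apply pow_lt; lra].
  assert (0 <= nu ^ 2 * BesselK nu u ^ 2) by (apply Rmult_le_pos; apply pow2_ge_0).
  assert (0 < u * BesselK nu u * - dBesselK nu u) by (repeat apply Rmult_lt_0_compat; lra).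
  lra.
- assert (Hu' : 0 < u) by lra.
  assert (H0 := BesselK_pos nu u Hu'); assert (H1 := dBesselK_neg nu u Hu').
  assert (H2 := sqr_decay C (- dBesselK nu u) u Hu ltac:(split; [lra | auto])).
  assert (0 <= (u ^ 2 + nu ^ 2) * BesselK nu u ^ 2 / u).
  { apply Rdiv_le_0_compat; [|lra].
    apply Rmult_le_pos; [apply Rplus_le_le_0_compat|]; apply pow2_ge_0. }
  assert (0 <= dBesselK nu u ^ 2) by apply pow2_ge_0.
  assert (u * dBesselK nu u ^ 2 <= u ^ 2 * dBesselK nu u ^ 2) by (apply Rmult_le_compat_r; [trivial | nra]).
  nra.
Qed.

(** Drop [u^2 K^2] from the lower bound and take square roots. *)
Lemma dBesselK_lt_nu (nu u : R) : 0 < u -> Rabs nu * BesselK nu u < - (u * dBesselK nu u).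
Proof.
intros Hu; assert (H := BesselK_log_derivative_lower nu u Hu).
assert (H0 := BesselK_pos nu u Hu); assert (H1 := dBesselK_neg nu u Hu).
rewrite <- (pow2_abs nu) in H; assert (Hn := Rabs_pos nu).
assert (0 < - (u * dBesselK nu u)) by nra.
assert (0 <= Rabs nu * BesselK nu u) by (apply Rmult_le_pos; lra).
assert ((Rabs nu * BesselK nu u) ^ 2 < (- (u * dBesselK nu u)) ^ 2).
{ assert (0 <= u ^ 2 * BesselK nu u ^ 2) by (apply Rmult_le_pos; apply pow2_ge_0); nra. }
nra.
Qed.

(** The coefficient [nu / (nu - 1)] makes the derivative of the difference a positive multiple of
    [- u K' - nu K], which is positive by [dBesselK_lt_nu]. *)
Lemma BesselK_log_derivative_upper (nu u : R) : 1 < nu -> 0 < u ->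
  u ^ 2 * dBesselK nu u ^ 2 < (nu / (nu - 1) * u ^ 2 + nu ^ 2) * BesselK nu u ^ 2.
Proof.
intros Hnu; destruct (dBesselK_decay nu) as [C [HC HCu]]; revert u.
assert (H := increasing_vanishing_neg
  (fun u => u ^ 2 * dBesselK nu u ^ 2 - (nu / (nu - 1) * u ^ 2 + nu ^ 2) * BesselK nu u ^ 2)
  (fun u => 2 * u * BesselK nu u * (- (u * dBesselK nu u) - nu * BesselK nu u) / (nu - 1)) (C ^ 2)).
intros u Hu; apply Rminus_lt, H; trivial; clear u Hu; intros u Hu.
- assert (H0 := is_derive_BesselK nu u Hu); assert (H1 := is_derive_dBesselK nu u Hu).
  fold (dBesselK nu u) in H0.
  auto_derive.
  + repeat split; eexists; eassumption.
  + rewrite Derive_BesselK, Derive_dBesselK by trivial; unfold d2BesselK; field; lra.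
- assert (H0 := BesselK_pos nu u Hu); assert (H1 := dBesselK_lt_nu nu u Hu).
  rewrite Rabs_pos_eq in H1 by lra.
  apply Rdiv_lt_0_compat; [|lra]; repeat apply Rmult_lt_0_compat; lra.
- assert (Hu' : 0 < u) by lra; assert (H1 := dBesselK_neg nu u Hu').
  assert (H2 := sqr_decay C (- dBesselK nu u) u Hu ltac:(split; [lra | auto])).
  assert (0 <= nu / (nu - 1)) by (apply Rdiv_le_0_compat; lra).
  assert (0 <= (nu / (nu - 1) * u ^ 2 + nu ^ 2) * BesselK nu u ^ 2).
  { apply Rmult_le_pos; [|apply pow2_ge_0].
    apply Rplus_le_le_0_compat; [apply Rmult_le_pos; trivial|]; apply pow2_ge_0. }
  nra.
Qed.

(** * Power means and convexity *)

(** An antiderivative of [x^(r-1)]. Dividing by [r] keeps it increasing for negative [r] too, so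
    means are compared without cases on the sign of the exponent. *)
Definition power_primitive (r x : R) : R :=
  if Req_EM_T r 0 then ln x else Rpower x r / r.

Lemma Rpower_pos (x y : R) : 0 < Rpower x y.
Proof. apply exp_pos. Qed.

Lemma is_derive_Rpower (a x : R) : 0 < x -> is_derive (fun z => Rpower z a) x (a * Rpower x (a - 1)).
Proof. intros Hx; apply is_derive_Reals; now apply derivable_pt_lim_power. Qed.

Lemma is_derive_power_primitive (r x : R) : 0 < x ->
  is_derive (power_primitive r) x (Rpower x (r - 1)).
Proof.
intros Hx; unfold power_primitive; destruct (Req_EM_T r 0) as [-> | Hr].
- replace (Rpower x (0 - 1)) with (/ x).
  + apply is_derive_Reals; now apply derivable_pt_lim_ln.
  + replace (0 - 1) with (- (1)) by ring; now rewrite Rpower_Ropp, Rpower_1.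
- apply (is_derive_ext (fun z => / r * Rpower z r)); [intros z; change (/ r * Rpower z r = Rpower z r / r); field; trivial|].
  replace (Rpower x (r - 1)) with (/ r * (r * Rpower x (r - 1))) by (field; trivial).
  now apply (is_derive_scal (fun z => Rpower z r)), is_derive_Rpower.
Qed.

Lemma power_primitive_lt (r x y : R) : 0 < x -> 0 < y ->
  power_primitive r x < power_primitive r y <-> x < y.
Proof.
assert (Hincr : forall x y, 0 < x -> x < y -> power_primitive r x < power_primitive r y).
{ apply strictly_increasing_of_derive with (fun x => Rpower x (r - 1)); intros.
  - now apply is_derive_power_primitive.
  - apply Rpower_pos. }
intros Hx Hy; split; [|now apply Hincr].
intros Hlt; apply Rnot_le_lt; intros [H | H].
- specialize (Hincr y x Hy H); lra.
- subst; lra.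
Qed.

Lemma power_primitive_le (r x y : R) : 0 < x -> 0 < y ->
  power_primitive r x <= power_primitive r y -> x <= y.
Proof.
intros Hx Hy H; apply Rnot_lt_le; intros Hlt.
apply (power_primitive_lt r) in Hlt; trivial; lra.
Qed.

Lemma convex_comb_pos (lam a b : R) : 0 <= lam <= 1 -> 0 < a -> 0 < b -> 0 < lam * a + (1 - lam) * b.
Proof. intros [[H0 | <-] H1] Ha Hb; [|lra]; assert (0 < lam * a) by (now apply Rmult_lt_0_compat); nra. Qed.

Lemma power_mean_pos (r lam x y : R) : 0 < power_mean r lam x y.
Proof.
unfold power_mean; destruct (Req_EM_T r 0); [apply Rmult_lt_0_compat|]; apply Rpower_pos.
Qed.

(** Power means are the quasi-arithmetic means generated by [power_primitive]; this reduces
    (p,q)-convexity to a Jensen inequality. *)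
Lemma power_primitive_mean (r lam x y : R) : 0 < x -> 0 < y -> 0 <= lam <= 1 ->
  power_primitive r (power_mean r lam x y)
  = lam * power_primitive r x + (1 - lam) * power_primitive r y.
Proof.
intros Hx Hy Hlam; unfold power_primitive, power_mean; destruct (Req_EM_T r 0) as [-> | Hr].
- now rewrite ln_mult by apply Rpower_pos; unfold Rpower; rewrite !ln_exp.
- rewrite Rpower_mult, Rinv_l, Rpower_1 by
    (trivial || (apply convex_comb_pos; trivial; apply Rpower_pos)).
  field; trivial.
Qed.

(** As a function of [P], [G] has the increasing slope [phi]. The derivative [(phi x - phi m) dP x]
    of [G - phi m * P] is negative before [m] and positive after it. *)
Lemma graph_above_tangent (G P phi dP : R -> R) :
  (forall u, 0 < u -> is_derive P u (dP u)) -> (forall u, 0 < u -> 0 < dP u) ->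
  (forall u, 0 < u -> is_derive G u (phi u * dP u)) ->
  (forall x y, 0 < x -> x < y -> phi x < phi y) ->
  forall m u, 0 < m -> 0 < u -> u <> m -> G m + phi m * (P u - P m) < G u.
Proof.
intros HP HdP HG Hphi m u Hm Hu Hum.
set (H := fun x => G x - phi m * P x).
assert (HH : forall x, 0 < x -> derivable_pt_lim H x ((phi x - phi m) * dP x)).
{ intros x Hx; apply is_derive_Reals.
  replace ((phi x - phi m) * dP x) with (minus (phi x * dP x) (phi m * dP x))
    by (unfold minus, plus, opp; simpl; ring).
  apply (is_derive_minus G); [now apply HG | now apply (is_derive_scal P), HP]. }
assert (H m < H u); [|unfold H in *; lra].
destruct (Rtotal_order u m) as [Hlt | [Heq | Hlt]]; [|easy|].
- destruct (MVT_cor2 H (fun x => (phi x - phi m) * dP x) u m Hlt) as [c [Hc Hucm]].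
  { intros; apply HH; lra. }
  assert (phi c < phi m) by (apply Hphi; lra).
  assert (0 < dP c) by (apply HdP; lra).
  assert (0 < (phi m - phi c) * dP c * (m - u)) by (repeat apply Rmult_lt_0_compat; lra).
  lra.
- destruct (MVT_cor2 H (fun x => (phi x - phi m) * dP x) m u Hlt) as [c [Hc Hucm]].
  { intros; apply HH; lra. }
  assert (phi m < phi c) by (apply Hphi; lra).
  assert (0 < dP c) by (apply HdP; lra).
  assert (0 < (phi c - phi m) * dP c * (u - m)) by (repeat apply Rmult_lt_0_compat; lra).
  lra.
Qed.

(* The sign [s = 1] gives convexity and [s = -1] concavity. *)
Lemma pq_jensen (f f1 f2 : R -> R) (p q s : R) :
  (forall u, 0 < u -> 0 < f u) ->
  (forall u, 0 < u -> is_derive f u (f1 u)) -> (forall u, 0 < u -> is_derive f1 u (f2 u)) ->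
  (forall u, 0 < u -> 0 < s * (u * f u * f2 u + (q - 1) * u * f1 u ^ 2 + (1 - p) * f u * f1 u)) ->
  forall u1 u2 lam, 0 < u1 -> 0 < u2 -> 0 <= lam <= 1 ->
    s * power_primitive q (f (power_mean p lam u1 u2))
      <= s * power_primitive q (power_mean q lam (f u1) (f u2)) /\
    (u1 <> u2 -> 0 < lam < 1 ->
     s * power_primitive q (f (power_mean p lam u1 u2))
      < s * power_primitive q (power_mean q lam (f u1) (f u2))).
Proof.
intros Hf Hf1 Hf2 Hs u1 u2 lam Hu1 Hu2 Hlam.
(* The slope of [s f^q / q] with respect to [u^p / p]. *)
set (phi := fun u => s * (Rpower u (1 - p) * Rpower (f u) (q - 1) * f1 u)).
assert (Hphi : forall x y, 0 < x -> x < y -> phi x < phi y).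
{ apply strictly_increasing_of_derive with (fun u => Rpower u (- p) * Rpower (f u) (q - 2) *
    (s * (u * f u * f2 u + (q - 1) * u * f1 u ^ 2 + (1 - p) * f u * f1 u))).
  - intros u Hu; unfold phi.
    assert (HA := is_derive_Rpower (1 - p) u Hu).
    assert (HB := is_derive_comp (fun z => Rpower z (q - 1)) f u _ _
                    (is_derive_Rpower (q - 1) (f u) (Hf u Hu)) (Hf1 u Hu)).
    assert (HAB := is_derive_mult _ _ _ _ _ HA HB Rmult_comm).
    assert (HABC := is_derive_scal _ _ s _ (is_derive_mult _ _ _ _ _ HAB (Hf2 u Hu) Rmult_comm)).
    evar_last; [exact HABC|].
    unfold plus, mult, scal; simpl; unfold mult; simpl.
    assert (E1 : Rpower u (1 - p) = u * Rpower u (- p)).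
    { rewrite <- (Rpower_1 u) at 2 by trivial; rewrite <- Rpower_plus; f_equal; ring. }
    assert (E2 : Rpower (f u) (q - 1) = f u * Rpower (f u) (q - 2)).
    { rewrite <- (Rpower_1 (f u)) at 2 by auto; rewrite <- Rpower_plus; f_equal; ring. }
    replace (1 - p - 1) with (- p) by ring; replace (q - 1 - 1) with (q - 2) by ring.
    rewrite E1, E2; ring.
  - intros u Hu; apply Rmult_lt_0_compat; [apply Rmult_lt_0_compat; apply Rpower_pos | auto]. }
set (G := fun u => s * power_primitive q (f u)).
set (m := power_mean p lam u1 u2).
assert (Hm : 0 < m) by apply power_mean_pos.
assert (Htan : forall u, 0 < u -> u <> m ->
  G m + phi m * (power_primitive p u - power_primitive p m) < G u).
{ intros u Hu Hum.
  apply (graph_above_tangent G (power_primitive p) phi (fun u => Rpower u (p - 1))); trivial.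
  - intros; now apply is_derive_power_primitive.
  - intros; apply Rpower_pos.
  - intros v Hv; unfold G, phi.
    evar_last.
    + apply is_derive_scal, (is_derive_comp (power_primitive q) f); [|now apply Hf1].
      now apply is_derive_power_primitive, Hf.
    + unfold scal; simpl; unfold mult; simpl.
      assert (E : Rpower v (1 - p) * Rpower v (p - 1) = 1).
      { rewrite <- Rpower_plus; replace (1 - p + (p - 1)) with 0 by ring; now apply Rpower_O. }
      transitivity (s * f1 v * Rpower (f v) (q - 1) * (Rpower v (1 - p) * Rpower v (p - 1)));
        [rewrite E|]; ring. }
assert (Htan' : forall u, 0 < u ->
  G m + phi m * (power_primitive p u - power_primitive p m) <= G u).
{ intros u Hu; destruct (Req_dec u m) as [-> | Hum]; [lra | left; now apply Htan]. }
assert (Hmean := power_primitive_mean p lam u1 u2 Hu1 Hu2 Hlam); fold m in Hmean.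
(* The linear terms of the tangent average to zero because [m] is the power mean. *)
assert (Havg : phi m * (lam * (power_primitive p u1 - power_primitive p m)
                + (1 - lam) * (power_primitive p u2 - power_primitive p m)) = 0).
{ rewrite Hmean; ring. }
rewrite (power_primitive_mean q) by auto.
fold (G m).
replace (s * (lam * power_primitive q (f u1) + (1 - lam) * power_primitive q (f u2)))
  with (lam * G u1 + (1 - lam) * G u2) by (unfold G; ring).
assert (H1 := Htan' u1 Hu1); assert (H2 := Htan' u2 Hu2).
split.
- assert (H1' := Rmult_le_compat_l lam _ _ ltac:(lra) H1).
  assert (H2' := Rmult_le_compat_l (1 - lam) _ _ ltac:(lra) H2).
  lra.
- intros Hne Hlam'.
  (* As [u1 <> u2], at least one of them differs from [m] and contributes a strict inequality. *)
  destruct (Req_dec u1 m) as [Heq | Hum].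
  + assert (H2' := Rmult_lt_compat_l (1 - lam) _ _ ltac:(lra) (Htan u2 Hu2 ltac:(congruence))).
    assert (H1' := Rmult_le_compat_l lam _ _ ltac:(lra) H1).
    lra.
  + assert (H1' := Rmult_lt_compat_l lam _ _ ltac:(lra) (Htan u1 Hu1 Hum)).
    assert (H2' := Rmult_le_compat_l (1 - lam) _ _ ltac:(lra) H2).
    lra.
Qed.

Lemma strictly_pq_convex_of_derivatives (f f1 f2 : R -> R) (p q : R) :
  (forall u, 0 < u -> 0 < f u) ->
  (forall u, 0 < u -> is_derive f u (f1 u)) -> (forall u, 0 < u -> is_derive f1 u (f2 u)) ->
  (forall u, 0 < u -> 0 < u * f u * f2 u + (q - 1) * u * f1 u ^ 2 + (1 - p) * f u * f1 u) ->
  strictly_pq_convex f p q.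
Proof.
intros Hf Hf1 Hf2 Hs.
assert (HJ := pq_jensen f f1 f2 p q 1 Hf Hf1 Hf2 ltac:(intros u Hu; rewrite Rmult_1_l; auto)).
split; intros u1 u2 lam Hu1 Hu2.
- intros Hlam; destruct (HJ u1 u2 lam Hu1 Hu2 Hlam) as [H _].
  apply (power_primitive_le q); [apply Hf, power_mean_pos | apply power_mean_pos | lra].
- intros Hne Hlam; destruct (HJ u1 u2 lam Hu1 Hu2 ltac:(lra)) as [_ H].
  apply (power_primitive_lt q); [apply Hf, power_mean_pos | apply power_mean_pos |].
  specialize (H Hne Hlam); lra.
Qed.

Lemma strictly_pq_concave_of_derivatives (f f1 f2 : R -> R) (p q : R) :
  (forall u, 0 < u -> 0 < f u) ->
  (forall u, 0 < u -> is_derive f u (f1 u)) -> (forall u, 0 < u -> is_derive f1 u (f2 u)) ->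
  (forall u, 0 < u -> u * f u * f2 u + (q - 1) * u * f1 u ^ 2 + (1 - p) * f u * f1 u < 0) ->
  strictly_pq_concave f p q.
Proof.
intros Hf Hf1 Hf2 Hs.
assert (HJ := pq_jensen f f1 f2 p q (- 1) Hf Hf1 Hf2
  ltac:(intros u Hu; specialize (Hs u Hu); lra)).
split; intros u1 u2 lam Hu1 Hu2.
- intros Hlam; destruct (HJ u1 u2 lam Hu1 Hu2 Hlam) as [H _].
  apply Rle_ge, (power_primitive_le q); [apply power_mean_pos | apply Hf, power_mean_pos | lra].
- intros Hne Hlam; destruct (HJ u1 u2 lam Hu1 Hu2 ltac:(lra)) as [_ H].
  apply (power_primitive_lt q); [apply power_mean_pos | apply Hf, power_mean_pos |].
  specialize (H Hne Hlam); lra.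
Qed.

(** * Sign conditions for the Bessel function *)

(** Multiplying the derivative criterion by [u] and inserting Bessel's equation yields the stated
    expression, which is [K^2 Q]. *)
Lemma BesselK_pq_convex (p q nu : R) :
  (forall u, 0 < u -> 0 < (u ^ 2 + nu ^ 2) * BesselK nu u ^ 2
     + (q - 1) * (u * dBesselK nu u) ^ 2 - p * BesselK nu u * (u * dBesselK nu u)) ->
  strictly_pq_convex (BesselK nu) p q.
Proof.
intros H; apply strictly_pq_convex_of_derivatives with (dBesselK nu) (d2BesselK nu).
- apply BesselK_pos.
- apply is_derive_BesselK.
- apply is_derive_dBesselK.
- intros u Hu; unfold d2BesselK; apply Rmult_lt_reg_r with u; trivial.
  rewrite Rmult_0_l; eapply Rlt_le_trans; [exact (H u Hu) | right; field; lra].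
Qed.

Lemma BesselK_pq_concave (p q nu : R) :
  (forall u, 0 < u -> (u ^ 2 + nu ^ 2) * BesselK nu u ^ 2
     + (q - 1) * (u * dBesselK nu u) ^ 2 - p * BesselK nu u * (u * dBesselK nu u) < 0) ->
  strictly_pq_concave (BesselK nu) p q.
Proof.
intros H; apply strictly_pq_concave_of_derivatives with (dBesselK nu) (d2BesselK nu).
- apply BesselK_pos.
- apply is_derive_BesselK.
- apply is_derive_dBesselK.
- intros u Hu; unfold d2BesselK; apply Rmult_lt_reg_r with u; trivial.
  rewrite Rmult_0_l; eapply Rle_lt_trans; [right | exact (H u Hu)]; field; lra.
Qed.

(* With [v > nu] the bound on [v^2] leaves [(q - 1/nu) v^2 + p v + nu > 0].
   For [nu <= 2] its discriminant is nonpositive; for [nu >= 2] its vertex lies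
   left of [nu], where its value is nonnegative. *)
Lemma quadratic_pos (p q nu u v : R) :
  p < 0 -> 1 <= q -> 1 < nu -> p ^ 2 <= 4 * (nu - 1) * ((q - 1) * nu + 1) ->
  nu < v -> v ^ 2 < nu / (nu - 1) * u ^ 2 + nu ^ 2 ->
  0 < u ^ 2 + nu ^ 2 + (q - 1) * v ^ 2 + p * v.
Proof.
intros Hp Hq Hnu Hpq Hv Hvu.
assert (Hu : (nu - 1) * (v ^ 2 - nu ^ 2) < nu * u ^ 2).
{ apply (Rmult_lt_compat_l (nu - 1)) in Hvu; [|lra].
  replace ((nu - 1) * (nu / (nu - 1) * u ^ 2 + nu ^ 2))
    with (nu * u ^ 2 + (nu - 1) * nu ^ 2) in Hvu by (field; lra).
  lra. }
assert (Hg : 0 <= (q * nu - 1) * v ^ 2 + p * nu * v + nu ^ 2).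
{ assert (HA : 0 < q * nu - 1) by nra.
  destruct (Rle_lt_dec nu 2) as [Hle | Hgt].
  - assert (Hdisc : p ^ 2 <= 4 * (q * nu - 1)).
    (* Four times this product is the gap between [4 (q nu - 1)] and the bound assumed on [p^2]. *)
    { assert (0 <= (2 - nu) * ((q - 1) * nu)) by (repeat apply Rmult_le_pos; lra); nra. }
    assert (Hsq : 0 <= (2 * (q * nu - 1) * v + p * nu) ^ 2) by apply pow2_ge_0.
    assert (nu ^ 2 * p ^ 2 <= nu ^ 2 * (4 * (q * nu - 1))) by (apply Rmult_le_compat_l; [apply pow2_ge_0 | trivial]).
    apply Rmult_le_reg_l with (4 * (q * nu - 1)); [lra|].
    nra.
  - set (a := nu - 1) in *; set (c := (q - 1) * nu) in *.
    assert (Ha : 1 <= a) by (unfold a; lra).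
    assert (Hc : 0 <= c) by (apply Rmult_le_pos; lra).
    assert (Hac : q * nu = a + c + 1) by (unfold a, c; ring).
    (* By AM-GM, [p^2 <= 4 a (c + 1) <= (a + c + 1)^2]; this makes the value at [v = nu]
       nonnegative. *)
    assert (Hend : - p <= q * nu).
    { apply Rnot_lt_le; intros Hlt; rewrite Hac in Hlt.
      assert ((a + c + 1) ^ 2 < p ^ 2) by nra.
      assert (0 <= (a - c - 1) ^ 2) by apply pow2_ge_0; nra. }
    (* From [a >= 1] and [c >= 0], [4 a (c + 1) <= 4 (a + c)^2]; this makes the slope at [v = nu]
       nonnegative. *)
    assert (Hvert : - p <= 2 * (q * nu - 1)).
    { apply Rnot_lt_le; intros Hlt; rewrite Hac in Hlt.
      assert ((2 * (a + c)) ^ 2 < p ^ 2) by nra.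
      nra. }
    assert (Hfac : (q * nu - 1) * v ^ 2 + p * nu * v + nu ^ 2
      = (v - nu) * ((q * nu - 1) * (v - nu) + nu * (2 * (q * nu - 1) + p)) + nu ^ 2 * (q * nu + p)) by ring.
    rewrite Hfac; apply Rplus_le_le_0_compat.
    + apply Rmult_le_pos; [lra|]; apply Rplus_le_le_0_compat; apply Rmult_le_pos; lra.
    + apply Rmult_le_pos; [apply pow2_ge_0 | lra]. }
apply Rmult_lt_reg_l with nu; [lra|].
nra.
Qed.

Theorem theorem4 (p q nu : R) :
  (p <= 0 -> q >= 1 -> nu > 1 ->
     4 * (1 - q) * p ^ 2 * nu ^ 2 + 4 * (q - 2) * p ^ 2 * nu + p ^ 2 * (p ^ 2 + 4) <= 0 ->
     strictly_pq_convex (BesselK nu) p q) /\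
  (p <= 0 -> q <= 0 -> strictly_pq_concave (BesselK nu) p q) /\
  (p >= 0 -> q < 0 -> Rabs nu >= - p / q -> strictly_pq_concave (BesselK nu) p q) /\
  (p >= 0 -> q >= 1 -> strictly_pq_convex (BesselK nu) p q) /\
  (p >= 1 -> q >= 0 -> strictly_pq_convex (BesselK nu) p q).
Proof.
(* Part (d) comes first because it also settles [p = 0] in part (a). All terms of [Q] are
   nonnegative here. *)
assert (Hd : p >= 0 -> q >= 1 -> strictly_pq_convex (BesselK nu) p q).
{ intros Hp Hq; apply BesselK_pq_convex; intros u Hu.
  assert (H0 := BesselK_pos nu u Hu); assert (H1 := dBesselK_neg nu u Hu).
  assert (0 < (u ^ 2 + nu ^ 2) * BesselK nu u ^ 2).
  { assert (0 <= nu ^ 2) by apply pow2_ge_0.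
    assert (0 < u ^ 2) by now apply pow_lt.
    apply Rmult_lt_0_compat; [lra | now apply pow_lt]. }
  assert (0 <= (q - 1) * (u * dBesselK nu u) ^ 2) by (apply Rmult_le_pos; [lra | apply pow2_ge_0]).
  assert (0 <= p * BesselK nu u * (u * - dBesselK nu u)) by (repeat apply Rmult_le_pos; lra).
  lra. }
refine (conj _ (conj _ (conj _ (conj Hd _)))).
- intros Hp Hq Hnu Hcond.
  destruct (Req_dec p 0) as [-> | Hp0]; [apply Hd; lra|].
  apply BesselK_pq_convex; intros u Hu.
  (* The condition of part (a) is [p^2] times this inequality. *)
  assert (Hpq : p ^ 2 <= 4 * (nu - 1) * ((q - 1) * nu + 1)).
  { apply Rmult_le_reg_l with (p ^ 2); [now apply pow2_gt_0 | lra]. }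
  assert (H0 := BesselK_pos nu u Hu); assert (H1 := dBesselK_lt_nu nu u Hu).
  assert (H2 := BesselK_log_derivative_upper nu u Hnu Hu).
  rewrite Rabs_pos_eq in H1 by lra.
  set (k := BesselK nu u) in *; set (v := - (u * dBesselK nu u) / k).
  assert (Hv : u * dBesselK nu u = - (v * k)) by (unfold v; field; lra).
  rewrite Hv in *.
  assert (0 < k ^ 2 * (u ^ 2 + nu ^ 2 + (q - 1) * v ^ 2 + p * v)); [|lra].
  apply Rmult_lt_0_compat; [now apply pow_lt|].
  apply quadratic_pos; try lra.
  + apply Rmult_lt_reg_r with k; trivial; lra.
  + apply Rmult_lt_reg_r with (k ^ 2); [now apply pow_lt|].
    rewrite <- Rpow_mult_distr, Hv in H2; lra.
(* Here [(q - 1) v^2 <= - v^2 < - (u^2 + nu^2)] and [p v <= 0]. *)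
- intros Hp Hq; apply BesselK_pq_concave; intros u Hu.
  assert (H0 := BesselK_pos nu u Hu); assert (H1 := dBesselK_neg nu u Hu).
  assert (H2 := BesselK_log_derivative_lower nu u Hu).
  rewrite <- Rpow_mult_distr in H2.
  assert (0 <= - q * (u * dBesselK nu u) ^ 2) by (apply Rmult_le_pos; [lra | apply pow2_ge_0]).
  assert (0 <= - p * BesselK nu u * (u * - dBesselK nu u)) by (repeat apply Rmult_le_pos; lra).
  lra.
(* From [p <= - q |nu|] and [|nu| < v] follows [p v <= - q v^2], so [Q <= u^2 + nu^2 - v^2 < 0]. *)
- intros Hp Hq Hnu; apply BesselK_pq_concave; intros u Hu.
  assert (H0 := BesselK_pos nu u Hu); assert (H1 := dBesselK_neg nu u Hu).
  assert (H2 := BesselK_log_derivative_lower nu u Hu); assert (H3 := dBesselK_lt_nu nu u Hu).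
  rewrite <- Rpow_mult_distr in H2.
  assert (Hpq : p <= - q * Rabs nu).
  { replace p with (- q * (- p / q)) by (field; lra); apply Rmult_le_compat_l; lra. }
  assert (Hx : 0 < - (u * dBesselK nu u)) by nra.
  assert (p * BesselK nu u <= - q * - (u * dBesselK nu u)).
  { apply Rle_trans with (- q * Rabs nu * BesselK nu u); [apply Rmult_le_compat_r; lra|].
    rewrite Rmult_assoc; apply Rmult_le_compat_l; lra. }
  nra.
(* [Q] splits into [u^2 + nu^2 - v^2 + v], positive by log-convexity, and
   [q v^2 + (p - 1) v >= 0]. *)
- intros Hp Hq; apply BesselK_pq_convex; intros u Hu.
  assert (H0 := BesselK_pos nu u Hu); assert (H1 := dBesselK_neg nu u Hu).
  assert (H2 := BesselK_log_convex nu u Hu).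
  rewrite <- Rpow_mult_distr in H2.
  assert (0 <= q * (u * dBesselK nu u) ^ 2) by (apply Rmult_le_pos; [lra | apply pow2_ge_0]).
  assert (0 <= (p - 1) * BesselK nu u * (u * - dBesselK nu u)) by (repeat apply Rmult_le_pos; lra).
  lra.
Qed.
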